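(* The system $\mathsf{S4}_\Box$ is sound and complete for the language $\mathcal{L}_\Box$ with respect to the class of evidence interaction models: a formula of $\mathcal{L}_\Box$ is a theorem of $\mathsf{S4}_\Box$ iff it is true at every evidence scenario of every evidence interaction model.
   Context: $\mathcal{L}_\Box$ is generated by $\phi ::= p \mid \neg\phi \mid \phi\wedge\psi \mid \Box\phi$, $p$ in a countable set $\textsc{prop}$. $\mathsf{S4}_\Box$: classical propositional logic with modus ponens, axioms $\Box(\phi\to\psi)\to(\Box\phi\to\Box\psi)$, $\Box\phi\to\phi$, $\Box\phi\to\Box\Box\phi$, and necessitation for $\Box$. An evidence interaction model is $(X,\mathcal{E},\oplus,I,v)$ where $(\mathcal{E},\oplus)$ is a meet-semilattice, $X$ nonempty, $I_e:X\to 2^X$ for $e\in\mathcal{E}$, $v:\textsc{prop}\to 2^X$, (E1) holds ($y\in I_e(x)$ implies $y\in I_e(y)$), and $I_{\oplus\mathcal{E}'}(x)=\bigcap_{e\in\mathcal{E}'}I_e(x)$ for all $x$ and finite nonempty $\mathcal{E}'\subseteq\mathcal{E}$. Let $U_e=\{x : x\in I_e(x)\}$; evidence scenarios are $(x,e)$ with $x\in U_e$. Truth: $p$ via $v$; Booleans as usual; $(x,e)\models\Box\phi$ iff some $e'\in\mathcal{E}$ has $x\in U_{e\oplus e'}\subseteq[\![\phi]\!]^e$, where $[\![\phi]\!]^e=\{y\in U_e : (y,e)\models\phi\}$. *)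

(* Defs.v *)
From mathcomp Require Import all_boot all_order.
From mathcomp Require Import boolp classical_sets.

Set Implicit Arguments.
Unset Strict Implicit.
Unset Printing Implicit Defensive.

Local Open Scope classical_set_scope.
Local Open Scope order_scope.

Inductive form (atom : Type) : Type :=
| Var of atom
| Neg of form atom
| And of form atom & form atom
| Box of form atom.

Definition Imp (atom : Type) (phi psi : form atom) : form atom :=
  Neg (And phi (Neg psi)).

(* [b] assigns truth values to the formulas that are not Boolean compounds,
   i.e. to variables and to boxed formulas; its other values are irrelevant. *)
Fixpoint bool_eval (atom : Type) (b : form atom -> bool) (phi : form atom)
    : bool :=
  match phi with
  | Neg psi => ~~ bool_eval b psi
  | And psi chi => bool_eval b psi && bool_eval b chi
  | Var _ | Box _ => b phi
  end.

(* Exactly the substitution instances of classical propositional tautologies. *)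
Definition tautology (atom : Type) (phi : form atom) : Prop :=
  forall b : form atom -> bool, bool_eval b phi.

Inductive S4 (atom : Type) : form atom -> Prop :=
| S4_taut phi : tautology phi -> S4 phi
| S4_K phi psi : S4 (Imp (Box (Imp phi psi)) (Imp (Box phi) (Box psi)))
| S4_T phi : S4 (Imp (Box phi) phi)
| S4_4 phi : S4 (Imp (Box phi) (Box (Box phi)))
| S4_MP phi psi : S4 (Imp phi psi) -> S4 phi -> S4 psi
| S4_nec phi : S4 phi -> S4 (Box phi).

(* In [infl_meet], a finite nonempty set of pieces of evidence is listed as
   [e :: s]; by the semilattice laws the iterated meet does not depend on the
   listing. A meet-semilattice need not have a top, so [e] itself is used as
   the initial value of the iteration. The decidable equality and choice operator
   carried by [meetSemilatticeType] are no restriction: classically (boolp)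
   every type has them. *)
Record evidence_model (atom : Type) : Type := EvidenceModel {
  state : Type;
  state_inhabited : inhabited state;
  evidence_disp : Order.disp_t;
  evidence : meetSemilatticeType evidence_disp;
  infl : evidence -> state -> set state;
  val_of : atom -> set state;
  infl_E1 : forall (e : evidence) (x y : state), infl e x y -> infl e y y;
  infl_meet : forall (e : evidence) (s : seq evidence) (x : state),
    infl (\big[Order.meet/e]_(e' <- s) e') x =
    \bigcap_(e' in [set` e :: s]) infl e' x
}.

Definition supp (atom : Type) (M : evidence_model atom) (e : evidence M)
    : set (state M) :=
  [set x | infl e x x].

(* Only meaningful at evidence scenarios, i.e. for [x] in [supp e]. *)
Fixpoint sat (atom : Type) (M : evidence_model atom) (e : evidence M)
    (x : state M) (phi : form atom) : Prop :=
  match phi with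
  | Var p => val_of p x
  | Neg psi => ~ sat e x psi
  | And psi chi => sat e x psi /\ sat e x chi
  | Box psi => exists e' : evidence M,
      supp (e `&` e') x /\
      supp (e `&` e') `<=` [set y | supp e y /\ sat e y psi]
  end.

Definition valid (atom : Type) (phi : form atom) : Prop :=
  forall (M : evidence_model atom) (x : state M) (e : evidence M),
    supp e x -> sat e x phi.

(* Main.v *)
Require Import Defs.
From mathcomp Require Import all_boot.
From mathcomp Require Import all_order boolp classical_sets.

(** Soundness: by the intersection condition the sets [supp (e `&` e')] form,
    for each fixed [e], a basis of a topology on [supp e], of which [Box] is
    the interior operator.
    Completeness: a preorder [R] on [W] gives an evidence model whose evidence
    is an arbitrary subset [A] of [W], with [infl A x] the interior of [A] for
    the topology of up-sets, whatever [x]; at the scenario [(x, setT)], [Box]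
    is then the Kripke box of [R]. Apply this to the canonical S4 frame. *)

Set Implicit Arguments.
Unset Strict Implicit.
Unset Printing Implicit Defensive.

Import Order.TTheory.
Local Open Scope classical_set_scope.

Section Soundness.
Variables (atom : Type) (M : evidence_model atom).
Implicit Types (e : evidence M) (x : state M) (phi psi : form atom).

Lemma supp_meet e e' : supp (e `&` e')%O = supp e `&` supp e'.
Proof.
have infl2 x : infl (e `&` e')%O x = infl e x `&` infl e' x.
  (* The iteration starts from [e], so over [[:: e']] it yields the meet with [e'] on the left;
     [meetC] restores the order. *)
  have := infl_meet e [:: e'] x; rewrite big_cons big_nil meetC => ->.
  apply/seteqP; split=> [y H|y [He He'] f].
    by split; apply: H; rewrite /= !inE eqxx ?orbT.
  by rewrite /= !inE => /orP[] /eqP->.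
by apply/seteqP; split=> x; rewrite /supp /= infl2.
Qed.

(** Truth at a fixed scenario is one of the valuations over which [tautology] quantifies. *)
Lemma sat_bool_eval e x phi :
  sat e x phi <-> bool_eval (fun psi => `[< sat e x psi >]) phi.
Proof.
elim: phi => [p|psi IH|psi IHpsi chi IHchi|psi _] /=.
- by split=> /asboolP.
- by rewrite IH; split=> /negP.
- by rewrite IHpsi IHchi; split=> /andP.
- by split=> /asboolP.
Qed.

Lemma sat_tautology e x phi : tautology phi -> sat e x phi.
Proof. by move=> taut; apply/sat_bool_eval; apply: taut. Qed.

Lemma sat_Imp e x phi psi :
  sat e x (Imp phi psi) <-> (sat e x phi -> sat e x psi).
Proof.
split=> /= [H phix|H [phix npsix]]; last exact/npsix/H.
by apply: contrapT => npsix; apply: H.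
Qed.

Lemma sat_Box e x psi : sat e x (Box psi) <->
  exists2 e', supp e x /\ supp e' x &
    forall y, supp e y -> supp e' y -> sat e y psi.
Proof.
split=> /= [[e'] |[e' [ex e'x] H]]; last first.
  by exists e'; rewrite supp_meet; split=> // y [ey e'y]; split=> //; apply: H.
rewrite supp_meet => -[[ex e'x] H].
by exists e' => // y ey e'y; have [] := H y (conj ey e'y).
Qed.

End Soundness.

Lemma S4_sound (atom : Type) (phi : form atom) : S4 phi -> valid phi.
Proof.
elim=> {phi} [phi taut|phi psi|phi|phi|phi psi _ IHimp _ IH|phi _ IH] M x e ex.
- exact: sat_tautology.
- apply/sat_Imp => /sat_Box[e1 [_ e1x] H1].
  apply/sat_Imp => /sat_Box[e2 [_ e2x] H2].
  apply/sat_Box; exists (e1 `&` e2)%O; first by rewrite supp_meet.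
  move=> y ey; rewrite supp_meet => -[e1y e2y].
  by have /sat_Imp := H1 y ey e1y; apply; apply: H2.
- by apply/sat_Imp => /sat_Box[e' [_ e'x]]; apply.
- apply/sat_Imp => /sat_Box[e' [_ e'x] H].
  (* A basic open set is a neighbourhood of each of its points, so the same [e'] serves at [y]. *)
  apply/sat_Box; exists e' => // y ey e'y.
  by apply/sat_Box; exists e'.
- by have /sat_Imp := IHimp M x e ex; apply; apply: IH.
- by apply/sat_Box; exists e => // y ey _; apply: IH.
Qed.

Section KripkeEvidence.
Variables (atom W : Type) (w0 : W) (R : W -> W -> Prop) (v : atom -> set W).

Definition kripke_infl (A : set W) (_ : W) : set W := [set y | R y `<=` A].

Lemma kripke_infl_E1 (A : set W) (x y : W) :
  kripke_infl A x y -> kripke_infl A y y.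
Proof. by []. Qed.

Lemma kripke_infl_meet (A : set W) (s : seq (set W)) (x : W) :
  kripke_infl (\big[Order.meet/A]_(B <- s) B) x =
  \bigcap_(B in [set` A :: s]) kripke_infl B x.
Proof.
elim: s => [|B s IH].
  by rewrite big_nil set_cons1 bigcap_set1.
have inflI C D : kripke_infl (C `&` D)%O x = kripke_infl C x `&` kripke_infl D x.
  by apply/seteqP; split=> y /=; rewrite /kripke_infl /= subsetI.
rewrite big_cons inflI IH; apply/seteqP; split=> y /=.
  move=> [By H] C; rewrite /= !inE => /or3P[/eqP->|/eqP->|Cs] //.
  - by apply: H; rewrite /= inE eqxx.
  - by apply: H; rewrite /= inE Cs orbT.
move=> H; split; first by apply: H; rewrite /= !inE eqxx orbT.
by move=> C; rewrite /= inE => CAs; apply: H; rewrite /= !inE orbCA CAs orbT.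
Qed.

Definition kripke_model : evidence_model atom :=
  EvidenceModel (inhabits w0) v kripke_infl_E1 kripke_infl_meet.

Hypothesis Rrefl : forall x, R x x.
Hypothesis Rtrans : forall x y z, R x y -> R y z -> R x z.

(** The support of [setT] is all of [W], so relativizing to the current evidence has no effect. By
    transitivity, supports are up-sets. *)
Lemma kripke_sat_Box (x : W) (psi : form atom) :
  sat (M := kripke_model) (setT : set W) x (Box psi) <->
  forall y, R x y -> sat (M := kripke_model) (setT : set W) y psi.
Proof.
split=> [/sat_Box[A [_ Ax] H] y Rxy|H].
  by apply: H => // z Ryz; apply: Ax; apply: Rtrans Ryz.
(* [R x] is the least neighbourhood of [x]; reflexivity puts its support inside it. *)
apply/sat_Box; exists (R x : set W); first by split.
by move=> y _ /(_ y (Rrefl y)); apply: H.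
Qed.

End KripkeEvidence.

Section Canonical.
Variable atom : Type.
Implicit Types (phi psi chi : form atom) (T : set (form atom)).

(** Closure is under modus ponens only: the formulas true at a single world need not be closed under
    necessitation. *)
Definition theory T : Prop :=
  @S4 atom `<=` T /\ forall phi psi, T (Imp phi psi) -> T phi -> T psi.

(** These are the maximal consistent sets: the equivalence is consistency from left to right and
    completeness from right to left. *)
Definition complete_theory T : Prop :=
  theory T /\ forall phi, T (Neg phi) <-> ~ T phi.

Lemma theory_tautology T phi : theory T -> tautology phi -> T phi.
Proof. by move=> [thm _] taut; apply/thm/S4_taut. Qed.

Lemma theory_tautology1 T phi psi :
  theory T -> tautology (Imp phi psi) -> T phi -> T psi.
Proof. by move=> thT taut; apply: thT.2; apply: theory_tautology. Qed.

Lemma theory_tautology2 T phi psi chi :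
  theory T -> tautology (Imp phi (Imp psi chi)) -> T phi -> T psi -> T chi.
Proof.
by move=> thT taut Tphi; apply: thT.2; apply: theory_tautology1 taut Tphi.
Qed.

Lemma S4_theory : theory (@S4 atom).
Proof. by split=> // phi psi; apply: S4_MP. Qed.

(** By the deduction theorem this is the least theory containing [T] and [psi]. *)
Lemma theory_Imp T psi : theory T -> theory [set chi | T (Imp psi chi)].
Proof.
move=> thT; split=> [chi /thT.1|chi1 chi2] /=.
  by apply: theory_tautology1 => // b /=; do 2 case: bool_eval.
by apply: theory_tautology2 => // b /=; do 3 case: bool_eval.
Qed.

(** Thanks to necessitation and K, [Lindenbaum] applies directly to the unboxed formulas of a world,
    with no finite conjunctions of boxes. *)
Lemma theory_Box T : theory T -> theory [set chi | T (Box chi)].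
Proof.
move=> thT; split=> [chi /S4_nec/thT.1 //|phi psi /= H].
by apply: thT.2; apply: thT.2 H; apply/thT.1/S4_K.
Qed.

(* The maximal element comes from Zorn's lemma; [set0] is admitted into the
   family only to bound the empty chain. *)
Lemma Lindenbaum T phi : theory T -> ~ T phi ->
  exists T', [/\ complete_theory T', T `<=` T' & ~ T' phi].
Proof.
move=> thT nTphi.
pose good A := [/\ theory A, T `<=` A & ~ A phi].
have good_T : good T by split.
have [F FP Fchain|A [PA maxA]] :=
    @Zorn_bigcup (form atom) [set A | A = set0 \/ good A].
  have [[A FA [thA TA _]]|nogood] := pselect (exists2 A, F A & good A); last first.
    left; apply/seteqP; split=> // psi [A FA Apsi].
    have [A0|goodA] := FP _ FA; first by rewrite A0 in Apsi.
    by case: nogood; exists A.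
  right; split.
  - split=> [psi /thA.1|psi chi [B FB Bimp] [C FC Cpsi]]; first by exists A.
    (* A member of the chain that has an element is not [set0], hence is a theory. *)
    have mem D xi : F D -> D xi -> theory D.
      by move=> /FP[->//|[]].
    have [BC|CB] := Fchain _ _ FB FC.
    + by exists C => //; apply: (mem C _ FC Cpsi).2 Cpsi; apply: BC.
    + by exists B => //; apply: (mem B _ FB Bimp).2 (CB _ Cpsi).
  - by move=> psi /TA; exists A.
  - by move=> [B FB Bphi]; case: (FP _ FB) => [B0|[]//]; rewrite B0 in Bphi.
have [thA TA nAphi] : good A.
  case: PA => [A0|//]; exfalso; apply: (maxA T); last by right.
  split; first by rewrite A0; apply: sub0set.
  rewrite A0 => /(_ (Imp phi phi)); apply.
  by apply: theory_tautology => // b /=; case: bool_eval.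
(* Otherwise adjoining [psi] to [A] would give a strictly larger theory that still omits [phi]. *)
have ext psi : ~ A psi -> A (Imp psi phi).
  move=> nApsi; apply: contrapT => nAimp.
  apply: (maxA [set chi | A (Imp psi chi)]).
    split=> [chi|/(_ psi) sub].
      by apply: theory_tautology1 => // b /=; do 2 case: bool_eval.
    apply/nApsi/sub; apply: (theory_tautology thA) => b /=.
    by case: bool_eval.
  right; split=> //; first exact: theory_Imp.
  move=> chi /TA.
  by apply: theory_tautology1 => // b /=; do 2 case: bool_eval.
exists A; split=> //; split=> // psi; split.
  move=> Anpsi Apsi; apply: nAphi.
  apply: theory_tautology2 Anpsi Apsi => // b /=.
  by do 2 case: bool_eval.
(* If [A] contained neither [psi] nor its negation, both would imply [phi] in [A], and [phi] would
   follow by cases. *)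
move=> /ext Aimp; apply: contrapT => /ext Aimp'; apply: nAphi.
apply: theory_tautology2 Aimp Aimp' => // b /=.
by do 2 case: bool_eval.
Qed.

Definition world : Type := {T : set (form atom) | complete_theory T}.

Definition access (x y : world) : Prop :=
  forall phi, sval x (Box phi) -> sval y phi.

Lemma access_refl x : access x x.
Proof.
case: x => T [thT cT] phi /=.
by apply: thT.2; apply/thT.1/S4_T.
Qed.

Lemma access_trans x y z : access x y -> access y z -> access x z.
Proof.
move=> Rxy Ryz phi Hx; apply/Ryz/Rxy.
case: x Hx {Rxy} => T [thT cT] /=.
by apply: thT.2; apply/thT.1/S4_4.
Qed.

Lemma access_Box (x : world) phi :
  sval x (Box phi) <-> forall y, access x y -> sval y phi.
Proof.
split=> [Hx y|H]; first exact.
apply: contrapT => nx.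
have thx : theory (sval x) by case: (svalP x).
(* Any world extending the unboxed formulas of [x] is accessible from [x]; this one omits [phi]. *)
have [T [cT sub nT]] := Lindenbaum (theory_Box thx) nx.
exact/nT/(H (exist _ T cT)).
Qed.

Definition canonical_model (w : world) : evidence_model atom :=
  kripke_model w access (fun p => [set x | sval x (Var p)]).

Lemma truth_lemma (w x : world) phi :
  sat (M := canonical_model w) (setT : set world) x phi <-> sval x phi.
Proof.
elim: phi x => [p|psi IH|psi IHpsi chi IHchi|psi IH] x.
- by [].
- by rewrite /= IH; case: (svalP x) => _ ->.
- rewrite /= IHpsi IHchi; case: (svalP x) => thx _; split=> [[]|H].
    by apply: theory_tautology2 => // b /=; do 2 case: bool_eval.
  split; apply: theory_tautology1 H => // b /=.
  + by do 2 case: bool_eval.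
  + by do 2 case: bool_eval.
- rewrite (kripke_sat_Box _ _ access_refl access_trans) access_Box.
  by split=> H y /H /IH.
Qed.

End Canonical.

Lemma S4_complete (atom : Type) (phi : form atom) : valid phi -> S4 phi.
Proof.
move=> validphi; apply: contrapT => nphi.
have [T [cT _ nT]] := Lindenbaum (@S4_theory atom) nphi.
pose w : world atom := exist _ T cT.
by apply/nT/(truth_lemma w w)/validphi.
Qed.

Theorem theorem8 (atom : countType) (phi : form atom) : S4 phi <-> valid phi.
Proof. by split; [exact: S4_sound|exact: S4_complete]. Qed.
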